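(* Let $R$ be a ring, let $C=\mathrm{Cent}(R)$, let $\sigma\in\mathrm{Aut}(C)$ and let $n\ge 1$ be an integer. Suppose that, up to isomorphism, $M=R_R$ is the only right $R$-module satisfying $M^n\cong R^n$. If $\mathrm{M}_n(R)$ has an involution (resp. anti-automorphism) of type $\sigma$, then $\mathrm{M}_2(R)$ (resp. $R$) has an involution (resp. anti-automorphism) of type $\sigma$.
   Context: Rings are unital. An involution is an anti-automorphism $\alpha$ with $\alpha\circ\alpha=\mathrm{id}$. The centers of the matrix rings $\mathrm{M}_m(R)$ are identified with $C=\mathrm{Cent}(R)$ via scalar matrices, and the type of an anti-automorphism (or involution) of $\mathrm{M}_m(R)$ is its restriction to the center, viewed as an automorphism of $C$. *)

(* Defs.v *)
From HB Require Import structures.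
From mathcomp Require Import all_boot all_order all_algebra.
From mathcomp Require Import boolp.

Set Implicit Arguments.
Unset Strict Implicit.
Unset Printing Implicit Defensive.

Import GRing.Theory.
Local Open Scope ring_scope.

(* Rings are pzRingType's: unital, not assumed commutative, zero ring allowed. *)

Section Center.
Variable R : pzRingType.

Definition central : {pred R} := fun x => `[< forall y : R, x * y = y * x >].

Lemma centralP (x : R) :
  reflect (forall y : R, x * y = y * x) (x \in central).
Proof. exact: asboolP. Qed.

Fact central_subring_closed : subring_closed central.
Proof.
split=> [|x z /centralP xC /centralP zC|x z /centralP xC /centralP zC];
  apply/centralP => y.
- by rewrite mul1r mulr1.
- by rewrite mulrBl mulrBr xC zC.
- by rewrite -mulrA zC !mulrA xC.
Qed.

HB.instance Definition _ :=
  GRing.isSubringClosed.Build R central central_subring_closed.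

Record center := Center { center_val :> R; center_valP : center_val \in central }.

HB.instance Definition _ := [isSub for center_val].
HB.instance Definition _ := [Choice of center by <:].
HB.instance Definition _ := GRing.SubChoice_isSubPzRing.Build R central center central_subring_closed.

Fact center_mulC : commutative (@GRing.mul center).
Proof. by move=> x y; apply: val_inj; rewrite !rmorphM; apply/centralP/valP. Qed.

HB.instance Definition _ := GRing.PzRing_hasCommutativeMul.Build center center_mulC.

End Center.

(* With S a ring and iota : center R -> S identifying center R with the center
   of S, f has type sigma when its restriction to the center of S is sigma. *)
Definition of_type (R S : pzRingType) (iota : center R -> S)
    (sigma : center R -> center R) (f : S -> S) : Prop :=
  forall c : center R, f (iota c) = iota (sigma c).

(* A ring morphism S -> S^c is a unital, additive, multiplication-reversing map. *)
Definition has_antiautomorphism (R S : pzRingType) (iota : center R -> S)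
    (sigma : center R -> center R) : Prop :=
  exists alpha : {rmorphism S -> S^c},
    bijective alpha /\ of_type iota sigma alpha.

Definition has_involution (R S : pzRingType) (iota : center R -> S)
    (sigma : center R -> center R) : Prop :=
  exists alpha : {rmorphism S -> S^c},
    [/\ bijective alpha, involutive (alpha : S -> S) & of_type iota sigma alpha].

Definition scalar_center (R : pzRingType) (m : nat) (c : center R) : 'M[R]_m :=
  (val c)%:M.

(* Right R-modules are left modules over the converse ring R^c. *)
Notation rmodType R := (lmodType R^c).

(* The right module R_R: here a *: x is the product x * a in R. *)
Definition regular_rmod (R : pzRingType) : rmodType R := (R^c)^o.

Lemma regular_rmod_scaleE (R : pzRingType) (a x : R) :
  (a : R^c) *: (x : regular_rmod R) = x * a :> R.
Proof. by []. Qed.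

Definition rmod_iso (R : pzRingType) (U V : rmodType R) : Prop :=
  exists f : {linear U -> V}, bijective f.

Definition rmod_pow (R : pzRingType) (U : rmodType R) (n : nat) : rmodType R :=
  {ffun 'I_n -> U}.

(* Main.v *)
From HB Require Import structures.
Require Import Defs.
From mathcomp Require Import all_boot all_order all_algebra.

Set Implicit Arguments.
Unset Strict Implicit.
Unset Printing Implicit Defensive.

Import GRing.Theory.
Local Open Scope ring_scope.

(** Let alpha be an anti-automorphism of M_n(R) and e = alpha(e_00).  The
    idempotents alpha(e_ii) are equivalent and sum to 1, so R^n is isomorphic
    to (e R^n)^n and hence e R^n to R: there are a column u and a row v
    with v u = 1 and u v = e.  Then beta(r) = v alpha(r e_00) u is an
    anti-automorphism of R, and alpha X = U X^* V, where X^* is the transpose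
    of beta(X), U has columns alpha(e_0l) u and V = U^-1 has rows
    v alpha(e_k0).  If alpha is an involution, h = U V^* satisfies
    h X^** = X h for all X; it commutes with the matrix units, so it is a
    scalar w, with beta(w) = w^-1.  With J = [[0,1],[w,0]] one has J^* = J^-1
    and J^2 = w, so X |-> J X^* J^* is an involution of M_2(R). *)

(** * Product-reversing maps as morphisms to the converse ring *)

Lemma antimorphismM (S : pzRingType) (f : {rmorphism S -> S^c}) (x y : S) :
  f (x * y) = (f y : S) * f x.
Proof. exact: rmorphM. Qed.

Lemma antimorphism_exists (S : pzRingType) (f : S -> S) :
  zmod_morphism f -> f 1 = 1 -> (forall x y, f (x * y) = f y * f x) ->
  exists g : {rmorphism S -> S^c}, forall x, g x = f x.
Proof.
move=> fB f1 fM.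
pose fa := GRing.isZmodMorphism.Build S S^c f fB.
pose fm := GRing.isMonoidMorphism.Build S S^c f (conj f1 fM).
pose g : {rmorphism S -> S^c} := HB.pack (f : S -> S^c) fa fm.
by exists g.
Qed.

(** * The right module cut out of [R^n] by an idempotent *)

Section FixedColumns.
Variables (R : pzRingType) (n : nat) (e : 'M[R]_n).

(** For idempotent [e] this is [e R^n]. Columns have type ['cV[R^c]_n] so that scaling acts on the
    right, while the product by [e] is taken over [R]. *)
Definition fixed_column : {pred 'cV[R^c]_n} :=
  fun x => e *m (x : 'cV[R]_n) == x.

Lemma fixed_columnP (x : 'cV[R]_n) : reflect (e *m x = x) (x \in fixed_column).
Proof. exact: eqP. Qed.

Fact fixed_column_closed : submod_closed fixed_column.
Proof.
split=> [|a x y /fixed_columnP ex /fixed_columnP ey]; apply/fixed_columnP.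
  exact: mulmx0.
apply/matrixP=> i j.
rewrite mxE [RHS]mxE [X in _ = X + _]mxE -[in RHS]ey -[in RHS]ex.
rewrite [X in _ = X + _](_ : _ = (e *m x : 'cV[R]_n) i j * (a : R)) //.
rewrite !mxE mulr_suml -big_split /=; apply: eq_bigr => k _.
by rewrite !mxE mulrDr mulrA.
Qed.

HB.instance Definition _ :=
  GRing.isSubmodClosed.Build R^c 'cV[R^c]_n fixed_column fixed_column_closed.

Record fixed_columns :=
  FixedColumns { fixed_val :> 'cV[R^c]_n; _ : fixed_val \in fixed_column }.

HB.instance Definition _ := [isSub for fixed_val].
HB.instance Definition _ := [Choice of fixed_columns by <:].
HB.instance Definition _ := [SubChoice_isSubLmodule of fixed_columns by <:].

(** The maps [(x_i) |-> \sum_i a_i x_i] and [y |-> (b_i y)_i] are mutually inverse. *)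
Lemma fixed_columns_pow_iso (m : nat) (a b : 'I_m -> 'M[R]_n) :
  (forall i, e *m b i = b i) ->
  (forall i j, b i *m a j = if i == j then e else 0) ->
  \sum_i a i *m b i = 1%:M ->
  rmod_iso (rmod_pow (fixed_columns : rmodType R) m) (rmod_pow (regular_rmod R) n).
Proof.
move=> eb ba ab.
pose sumcol (x : rmod_pow (fixed_columns : rmodType R) m) : 'cV[R]_n :=
  \sum_i a i *m (val (x i) : 'cV[R]_n).
pose f (x : rmod_pow (fixed_columns : rmodType R) m) :
  rmod_pow (regular_rmod R) n := [ffun k => sumcol x k 0].
have b_fixed i (y : 'cV[R]_n) : (b i *m y) \in fixed_column.
  by apply/fixed_columnP; rewrite mulmxA eb.
pose g (y : rmod_pow (regular_rmod R) n) :
    rmod_pow (fixed_columns : rmodType R) m :=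
  [ffun i => FixedColumns (b_fixed i (\col_k y k))].
have f_linear : linear f.
  move=> r x y; apply/ffunP => k; rewrite !ffunE.
  rewrite [RHS](_ : _ = sumcol x k 0 * (r : R) + sumcol y k 0) //.
  rewrite !summxE mulr_suml -big_split; apply: eq_bigr => i _ /=.
  rewrite !mxE mulr_suml -big_split; apply: eq_bigr => j _ /=.
  by rewrite !ffunE !mxE mulrDr mulrA.
pose fl : {linear rmod_pow (fixed_columns : rmodType R) m ->
                  rmod_pow (regular_rmod R) n} :=
  HB.pack f (GRing.isLinear.Build _ _ _ _ f f_linear).
exists fl; exists g => [x | y].
- apply/ffunP => i; apply: val_inj; rewrite ffunE /=.
  have -> : \col_k f x k = sumcol x.
    by apply/matrixP => k l; rewrite mxE ffunE ord1.
  rewrite /sumcol mulmx_sumr (bigD1 i) //= big1 => [|j ji].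
    rewrite addr0 mulmxA ba eqxx.
    by case: (x i) => z z_fixed; apply/fixed_columnP.
  by rewrite mulmxA ba eq_sym (negbTE ji) mul0mx.
- apply/ffunP => k; rewrite ffunE.
  suff -> : sumcol (g y) = \col_k y k by rewrite mxE.
  rewrite -[RHS](@mul1mx R) -ab mulmx_suml; apply: eq_bigr => i _.
  by rewrite ffunE /= mulmxA.
Qed.

(** An isomorphism [g] from [e R^n] to [R] is left multiplication by the row [v] of its values on
    the columns of [e]; its inverse is [r |-> u r], where [u] is the preimage of [1]. *)
Lemma fixed_columns_regular :
  e *m e = e -> rmod_iso (fixed_columns : rmodType R) (regular_rmod R) ->
  exists u : 'cV[R]_n, exists v : 'rV[R]_n, v *m u = 1%:M /\ u *m v = e.
Proof.
move=> ee [g [h gh hg]].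
have col_fixed j : col j e \in fixed_column.
  by apply/fixed_columnP; rewrite colE mulmxA ee.
pose p j : fixed_columns := FixedColumns (col_fixed j).
pose u : 'cV[R]_n := val (h 1).
pose v : 'rV[R]_n := \row_j g (p j).
have gE (x : fixed_columns) : (v *m (val x : 'cV[R]_n)) 0 0 = g x.
  (* Reading [x = e x] columnwise writes [x] as a combination of the columns of [e] whose
     coefficients are its own entries. *)
  have {2}-> : x = \sum_j (val x j 0 : R^c) *: p j.
    apply: val_inj; rewrite linear_sum /=; apply/matrixP => i k.
    have /fixed_columnP x_fixed : val x \in fixed_column by case: (x).
    rewrite [k]ord1 summxE -{1}x_fixed mxE; apply: eq_bigr => j _.
    by rewrite !mxE.
  rewrite linear_sum mxE; apply: eq_bigr => j _.
  by rewrite linearZ mxE.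
have uE (r : R) : h r = (r : R^c) *: h 1.
  apply: (can_inj gh); rewrite hg linearZ hg.
  by rewrite -[LHS]mul1r.
exists u, v; split.
  by apply/matrixP => i j; rewrite !ord1 gE hg mxE eqxx.
apply/matrixP => i j; rewrite mxE big_ord1.
have : val (p j) i 0 = e i j by rewrite mxE.
by rewrite -[p j]gh uE mxE [X in _ -> _ * X = _]mxE.
Qed.

End FixedColumns.

(** * Central scalars and matrix units over a noncommutative ring *)

Lemma mulmx_central_scalar (R : pzRingType) (m n : nat) (A : 'M[R]_(m, n))
    (c : center R) : A *m (val c)%:M = val c *: A.
Proof.
have c_comm x : val c * x = x * val c by apply/centralP/valP.
apply/matrixP => i j; rewrite !mxE (bigD1 j) //= big1 => [|k /negbTE kj].
  by rewrite addr0 mxE eqxx mulr1n c_comm.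
by rewrite mxE kj mulr0n mulr0.
Qed.

Lemma mul_delta_mx_delta (R : pzRingType) (m n p q : nat) (A : 'M[R]_(n, p))
    (i : 'I_m) (j : 'I_n) (k : 'I_p) (l : 'I_q) :
  delta_mx i j *m A *m delta_mx k l = A j k *: delta_mx i l.
Proof.
apply/matrixP => x y; rewrite !mxE (bigD1 k) //= big1 => [|z /negbTE zk].
  rewrite addr0 !mxE (bigD1 j) //= big1 => [|z /negbTE zj].
    rewrite !mxE !eqxx andbT addr0.
    by case: (x == i); case: (y == l); rewrite /= ?(mul1r, mul0r, mulr1, mulr0).
  by rewrite mxE zj andbF mul0r.
by rewrite !mxE zk mulr0.
Qed.

(** * Transposition twisted by a product-reversing map *)

Section Antitranspose.
Variables (R : pzRingType) (beta : {rmorphism R -> R^c}).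

Definition antitranspose (m n : nat) (A : 'M[R]_(m, n)) : 'M[R]_(n, m) :=
  \matrix_(i, j) beta (A j i).

Lemma antitransposeM (m n p : nat) (A : 'M[R]_(m, n)) (B : 'M[R]_(n, p)) :
  antitranspose (A *m B) = antitranspose B *m antitranspose A.
Proof.
apply/matrixP => i j; rewrite !mxE raddf_sum; apply: eq_bigr => k _.
by rewrite !mxE; apply: antimorphismM.
Qed.

Lemma antitransposeB (m n : nat) (A B : 'M[R]_(m, n)) :
  antitranspose (A - B) = antitranspose A - antitranspose B.
Proof. by apply/matrixP => i j; rewrite !mxE rmorphB. Qed.

Lemma antitranspose_scalar (n : nat) (a : R) :
  antitranspose (a%:M : 'M_n) = (beta a : R)%:M.
Proof. by apply/matrixP => i j; rewrite !mxE rmorphMn eq_sym. Qed.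

Lemma antitranspose1 (n : nat) : antitranspose (1%:M : 'M_n) = 1%:M.
Proof. by rewrite antitranspose_scalar rmorph1. Qed.

Lemma antitranspose_delta (m n : nat) (i : 'I_m) (j : 'I_n) :
  antitranspose (delta_mx i j) = delta_mx j i.
Proof. by apply/matrixP => k l; rewrite !mxE rmorph_nat andbC. Qed.

End Antitranspose.

(** * Normal form of anti-automorphisms of a matrix ring *)

Section MatrixAntiautomorphism.
Variables (R : pzRingType) (n : nat).
Variable alpha : {rmorphism 'M[R]_n.+1 -> ('M[R]_n.+1)^c}.

Let e : 'M[R]_n.+1 := alpha (delta_mx 0 0).

Lemma antiautomorphism_mulmx (A B : 'M[R]_n.+1) :
  alpha (A *m B) = (alpha B : 'M_n.+1) *m alpha A.
Proof. exact: antimorphismM. Qed.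

Lemma antiautomorphism_sum_delta :
  \sum_i (alpha (delta_mx i i) : 'M[R]_n.+1) = 1%:M.
Proof.
rewrite -[RHS](rmorph1 alpha) [X in _ = alpha X](mx1_sum_delta R n.+1).
by rewrite raddf_sum.
Qed.

(** With [a_i = alpha(e_0i)] and [b_i = alpha(e_i0)], reversal of products gives
    [a_i b_i = alpha(e_ii)] and [b_i a_j = alpha(e_0j e_i0)], which is [e] or [0]. *)
Lemma antiautomorphism_idempotent_fixed_columns :
  rmod_iso (rmod_pow (fixed_columns e : rmodType R) n.+1)
           (rmod_pow (regular_rmod R) n.+1).
Proof.
apply: (@fixed_columns_pow_iso _ _ e _
          (fun i => alpha (delta_mx 0 i)) (fun i => alpha (delta_mx i 0))).
- by move=> i; rewrite -antiautomorphism_mulmx mul_delta_mx.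
- move=> i j; rewrite -antiautomorphism_mulmx mul_delta_mx_cond eq_sym.
  by case: eqP => // _; rewrite mulr0n rmorph0.
- under eq_bigr do rewrite -antiautomorphism_mulmx mul_delta_mx.
  exact: antiautomorphism_sum_delta.
Qed.

Lemma antiautomorphism_antitranspose (u : 'cV[R]_n.+1) (v : 'rV[R]_n.+1) :
  bijective alpha -> v *m u = 1%:M -> u *m v = e ->
  exists beta : {rmorphism R -> R^c}, bijective beta /\
  exists U V : 'M[R]_n.+1, [/\ U *m V = 1%:M, V *m U = 1%:M &
    forall X, alpha X = U *m antitranspose beta X *m V].
Proof.
move=> [alphai alphaK alphaiK] vu uv.
pose b (r : R) : R := (v *m (alpha (r *: delta_mx 0 0) : 'M_n.+1) *m u) 0 0.
have bB : zmod_morphism b.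
  move=> x y; rewrite /b scalerBl rmorphB.
  by rewrite [_ *m (_ - _)]mulmxBr mulmxBl !mxE.
have b1 : b 1 = 1.
  by rewrite /b scale1r -/e -uv !mulmxA vu mul1mx vu mxE eqxx.
have bM x y : b (x * y) = b y * b x.
  rewrite /b; pose E : 'M[R]_n.+1 := delta_mx 0 0.
  have EyE : E *m (y *: E) = y *: E.
    by rewrite -mul_scalar_mx mulmxA mul_delta_mx_delta mxE eqxx mul_scalar_mx.
  (* Under [alpha] the extra middle [E] becomes [e = u v], which splits the expression into two 1 by
     1 factors. *)
  have -> : (x * y) *: E = (x *: E) *m E *m (y *: E).
    by rewrite -!scalemxAl -mulmxA !EyE scalerA.
  rewrite !antiautomorphism_mulmx -/e -uv.
  rewrite (_ : _ *m _ *m u = (v *m (alpha (y *: delta_mx 0 0) : 'M_n.+1) *m u) *m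
     (v *m (alpha (x *: delta_mx 0 0) : 'M_n.+1) *m u)).
    by rewrite mxE big_ord1.
  by rewrite !mulmxA.
have [beta betaE] := antimorphism_exists bB b1 bM.
pose U : 'M[R]_n.+1 := \matrix_(i, l) ((alpha (delta_mx 0 l) : 'M_n.+1) *m u) i 0.
pose V : 'M[R]_n.+1 := \matrix_(k, j) (v *m (alpha (delta_mx k 0) : 'M_n.+1)) 0 j.
have colU l : col l U = (alpha (delta_mx 0 l) : 'M_n.+1) *m u.
  by apply/matrixP => i j; rewrite ord1 !mxE.
have rowV k : row k V = v *m (alpha (delta_mx k 0) : 'M_n.+1).
  by apply/matrixP => i j; rewrite ord1 !mxE.
(* Entry [(k, l)] is [v alpha(e_k0) alpha(X) alpha(e_0l) u = v alpha(e_0l X e_k0) u], and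
   [e_0l X e_k0] is [X l k] times [e_00]. *)
have sandwich X : V *m (alpha X : 'M_n.+1) *m U = antitranspose beta X.
  apply/matrixP => k l; rewrite [RHS]mxE betaE /b.
  have -> : X l k *: delta_mx 0 0 =
      (delta_mx 0 l : 'M_n.+1) *m X *m (delta_mx k 0 : 'M_n.+1).
    by rewrite mul_delta_mx_delta.
  rewrite !antiautomorphism_mulmx !mulmxA -rowV.
  rewrite -[_ *m _ *m u]mulmxA -colU -row_mul mxE [RHS]mxE.
  by apply: eq_bigr => j _; congr (_ * _); rewrite [RHS]mxE.
have VU : V *m U = 1%:M.
  have := sandwich 1%:M.
  by rewrite (rmorph1 alpha) antitranspose1 [V *m _]mulmx1.
(* A one-sided inverse need not be two-sided over [R], so this is proved separately: column [k] of
   [U] times row [k] of [V] is [alpha(e_0k) e alpha(e_k0) = alpha(e_kk)]. *)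
have UV : U *m V = 1%:M.
  have -> : U *m V = \sum_k col k U *m row k V.
    apply/matrixP => i j; rewrite mxE summxE; apply: eq_bigr => k _.
    by rewrite [RHS]mxE big_ord1; congr (_ * _); rewrite [RHS]mxE.
  under eq_bigr => k _ do rewrite colU rowV mulmxA -(mulmxA _ u) uv
    -!antiautomorphism_mulmx !mul_delta_mx.
  exact: antiautomorphism_sum_delta.
exists beta; split; last first.
  exists U, V; split=> // X.
  by rewrite -sandwich !mulmxA UV mul1mx -mulmxA UV mulmx1.
(* The inverse of [beta] is read off from [alpha (r e_00) = U (beta(r) e_00) V]. *)
exists (fun t => (alphai (U *m (t *: delta_mx 0 0) *m V) : 'M_n.+1) 0 0).
  move=> r.
  have -> : (beta r : R) *: (delta_mx 0 0 : 'M[R]_n.+1) =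
      antitranspose beta (r *: (delta_mx 0 0 : 'M_n.+1)).
    apply/matrixP => i j; rewrite !mxE antimorphismM rmorph_nat andbC.
    by rewrite mulr_natl mulr_natr.
  rewrite -sandwich !mulmxA UV mul1mx -mulmxA UV mulmx1 alphaK.
  by rewrite !mxE mulr1.
move=> t.
have := sandwich (alphai (U *m (t *: delta_mx 0 0) *m V)).
rewrite alphaiK !mulmxA VU mul1mx -mulmxA VU mulmx1 => /matrixP/(_ 0 0).
by rewrite !mxE /= mulr1.
Qed.

End MatrixAntiautomorphism.

(** * The unit attached to an involution *)

Lemma comm_delta_mx_scalar (R : pzRingType) (n : nat) (A : 'M[R]_n.+1) :
  (forall i, A *m delta_mx i 0 = delta_mx i 0 *m A) -> A = (A 0 0)%:M.
Proof.
move=> A_comm; apply/matrixP => i j.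
(* The left side is [A i j] times [e_00]; the right side is [e_00 A] if [i = j] and [0] otherwise.
   Comparing entries [(0, 0)] gives the claim. *)
have /matrixP/(_ 0 0) : (delta_mx 0 i : 'M_n.+1) *m A *m delta_mx j 0 =
    (delta_mx 0 i : 'M_n.+1) *m delta_mx j 0 *m A.
  by rewrite -!mulmxA A_comm.
rewrite mul_delta_mx_delta mul_delta_mx_cond.
rewrite [LHS]mxE [in LHS]mxE mulr1 [RHS]mxE => ->.
rewrite (bigD1 0) //= big1 => [|k /negbTE k0].
  by rewrite addr0 !mxE mulmxnE !mxE mulr_natl mulrb; case: eqP.
by rewrite mulmxnE !mxE k0 mul0rn mul0r.
Qed.

Lemma involution_antitranspose (R : pzRingType) (n : nat)
    (beta : {rmorphism R -> R^c}) (U V : 'M[R]_n.+1) :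
  U *m V = 1%:M -> V *m U = 1%:M ->
  involutive (fun X => U *m antitranspose beta X *m V) ->
  exists w w' : R, [/\ w * w' = 1, w' * w = 1, beta w = w' &
    forall r, w * beta (beta r : R) = r * w].
Proof.
move=> UV VU invol.
pose tr (X : 'M[R]_n.+1) := antitranspose beta X.
have trM X Y : tr (X *m Y) = tr Y *m tr X by exact: antitransposeM.
have tr1 : tr 1%:M = 1%:M by exact: antitranspose1.
pose h := U *m tr V; pose h' := tr U *m V.
have hh' : h *m h' = 1%:M.
  by rewrite mulmxA -(mulmxA U) -trM UV tr1 mulmx1.
have h'h : h' *m h = 1%:M.
  by rewrite mulmxA -(mulmxA _ V) VU mulmx1 -trM VU tr1.
have h_comm X : h *m tr (tr X) = X *m h.
  (* Expanding the square of the involution gives [U V^* X^** U^* V = X]. *)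
  have XE : h *m tr (tr X) *m h' = X.
    by rewrite -[RHS]invol -/(tr _) -/(tr _) !trM /h /h' !mulmxA.
  by rewrite -[in RHS]XE -mulmxA h'h mulmx1.
have h_scalar : h = (h 0 0)%:M.
  by apply: comm_delta_mx_scalar => j; rewrite -h_comm /tr !antitranspose_delta.
have tr_h : tr h = h'.
  (* Here [h^* = V^** U^*], and [h V^** = V h] turns [h h^*] into [V U V^* U^* = (U V)^*]. Thus
     [h^*] is a right inverse of [h], hence equals its left inverse [h']. *)
  have h_tr_h : h *m tr h = 1%:M.
    rewrite [tr h]trM mulmxA h_comm [V *m h]mulmxA VU mul1mx -trM UV.
    exact: tr1.
  by rewrite -[tr h]mul1mx -h'h -mulmxA h_tr_h mulmx1.
pose w := h 0 0; pose w' := h' 0 0.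
exists w, w'; split.
- have : w%:M *m h' = 1%:M by rewrite -h_scalar.
  by rewrite mul_scalar_mx => /matrixP/(_ 0 0); rewrite mxE [RHS]mxE eqxx.
- have : h' *m w%:M = 1%:M by rewrite -h_scalar.
  move/matrixP/(_ 0 0); rewrite mxE (bigD1 0) //= big1 => [|i /negbTE i0].
    by rewrite [X in _ * X]mxE [RHS]mxE eqxx addr0.
  by rewrite [X in _ * X]mxE i0 mulr0n mulr0.
- by rewrite /w' -tr_h [RHS]mxE.
- move=> r; have := h_comm r%:M.
  rewrite /tr !antitranspose_scalar [h]h_scalar -!scalar_mxM.
  by move=> /matrixP/(_ 0 0); rewrite mxE [RHS]mxE.
Qed.

(** * The involution on 2 by 2 matrices *)

Lemma involution_mx2 (R : pzRingType) (sigma : center R -> center R)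
    (beta : {rmorphism R -> R^c}) (w w' : R) :
  w * w' = 1 -> w' * w = 1 -> beta w = w' ->
  (forall r, w * beta (beta r : R) = r * w) ->
  of_type (@center_val R) sigma beta ->
  has_involution (@scalar_center R 2) sigma.
Proof.
move=> ww' w'w beta_w beta2 beta_sigma.
have beta_w' : beta w' = w.
  have : (beta w' : R) * beta w = 1.
    by rewrite -antimorphismM ww' rmorph1.
  by rewrite beta_w => /(congr1 (fun x => x * w)); rewrite -mulrA w'w mulr1 mul1r.
(* [J] acts as a square root of [w] with [J^* = J^-1], which [R] itself may fail to contain. *)
pose J : 'M[R]_2 := delta_mx 0 1 + w *: delta_mx 1 0.
pose J' : 'M[R]_2 := delta_mx 1 0 + w' *: delta_mx 0 1.
pose tr (X : 'M[R]_2) := antitranspose beta X.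
have trM X Y : tr (X *m Y) = tr Y *m tr X by exact: antitransposeM.
have trJ : tr J = J'.
  apply/matrixP => i j; rewrite !mxE rmorphD antimorphismM !rmorph_nat beta_w.
  by rewrite mulr_natl mulr_natr andbC [(i == 0) && _]andbC.
have trJ' : tr J' = J.
  apply/matrixP => i j; rewrite !mxE rmorphD antimorphismM !rmorph_nat beta_w'.
  by rewrite mulr_natl mulr_natr andbC [(i == 1) && _]andbC.
have mxE2 := (mxE, big_ord_recl, big_ord0).
have JJ' : J *m J' = 1%:M.
  apply/matrixP => [[[|[]]//= ?] [[|[]]//= ?]];
    by rewrite !mxE2 /= ?(mulr0, mul0r, mulr1, mul1r, addr0, add0r).
have J'J : J' *m J = 1%:M.
  apply/matrixP => [[[|[]]//= ?] [[|[]]//= ?]];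
    by rewrite !mxE2 /= ?(mulr0, mul0r, mulr1, mul1r, addr0, add0r).
have JJ : J *m J = w%:M.
  apply/matrixP => [[[|[]]//= ?] [[|[]]//= ?]];
    by rewrite !mxE2 /= ?(mulr0, mul0r, mulr1, mul1r, addr0, add0r).
have J'J' : J' *m J' = w'%:M.
  apply/matrixP => [[[|[]]//= ?] [[|[]]//= ?]];
    by rewrite !mxE2 /= ?(mulr0, mul0r, mulr1, mul1r, addr0, add0r).
have tr_tr X : w%:M *m tr (tr X) = X *m w%:M.
  apply/matrixP => i j; rewrite mul_scalar_mx !mxE beta2.
  rewrite (bigD1 j) //= big1 => [|k /negbTE kj].
    by rewrite mxE eqxx addr0.
  by rewrite mxE kj mulr0n mulr0.
pose gamma X := J *m tr X *m J'.
have gammaB : zmod_morphism gamma.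
  by move=> X Y; rewrite /gamma /tr antitransposeB mulmxBr mulmxBl.
have gamma1 : gamma 1 = 1.
  by rewrite /gamma /tr [antitranspose _ _]antitranspose1 mulmx1 JJ'.
have gammaM X Y : gamma (X * Y) = gamma Y * gamma X.
  rewrite /gamma -[X * Y]/(X *m Y) trM -[RHS]/(_ *m _) !mulmxA.
  by rewrite -(mulmxA _ J' J) J'J mulmx1.
have gammaK : involutive gamma.
  (* The square of [gamma] sends [X] to [J^2 X^** J'^2 = w X^** w' = X w w']. *)
  move=> X; rewrite /gamma !trM trJ trJ' !mulmxA JJ tr_tr -mulmxA J'J'.
  by rewrite -mulmxA -scalar_mxM ww' mulmx1.
have [g gE] := antimorphism_exists gammaB gamma1 gammaM.
have gK : involutive (g : 'M[R]_2 -> 'M[R]_2) by move=> X; rewrite !gE.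
exists g; split=> //; first by exists g.
move=> c; rewrite gE /gamma /tr /scalar_center antitranspose_scalar beta_sigma.
by rewrite mulmx_central_scalar -scalemxAl JJ' scalemx1.
Qed.

Theorem theorem7p2 (R : pzRingType)
    (sigma : {rmorphism center R -> center R}) (sigma_bij : bijective sigma)
    (n : nat) (n_ge1 : (1 <= n)%N)
    (R_unique : forall M : rmodType R,
       rmod_iso (rmod_pow M n) (rmod_pow (regular_rmod R) n) ->
       rmod_iso M (regular_rmod R)) :
  (has_involution (@scalar_center R n) sigma ->
     has_involution (@scalar_center R 2) sigma)
  /\
  (has_antiautomorphism (@scalar_center R n) sigma ->
     has_antiautomorphism (@center_val R) sigma).
Proof.
case: n n_ge1 R_unique => // n _ R_unique.
have key (alpha : {rmorphism 'M[R]_n.+1 -> ('M[R]_n.+1)^c}) :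
    bijective alpha -> of_type (@scalar_center R n.+1) sigma alpha ->
    exists beta : {rmorphism R -> R^c},
      [/\ bijective beta, of_type (@center_val R) sigma beta &
       exists U V : 'M[R]_n.+1, [/\ U *m V = 1%:M, V *m U = 1%:M &
         forall X, alpha X = U *m antitranspose beta X *m V]].
  move=> alpha_bij alpha_sigma.
  (* The uniqueness hypothesis is applied to the module [e R^n]. *)
  have iso := R_unique _ (antiautomorphism_idempotent_fixed_columns alpha).
  have idem : (alpha (delta_mx 0 0) : 'M[R]_n.+1) *m alpha (delta_mx 0 0) =
      alpha (delta_mx 0 0).
    by rewrite -antiautomorphism_mulmx mul_delta_mx.
  have [u [v [vu uv]]] := fixed_columns_regular idem iso.
  have [beta [beta_bij [U [V [UV VU alphaE]]]]] :=
    antiautomorphism_antitranspose alpha_bij vu uv.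
  exists beta; split=> //; last by exists U, V.
  (* Both [beta(c)] and [sigma(c)] arise by computing [V alpha(c) U]: once from the normal form,
     once from the type of [alpha], where the central [sigma(c)] moves past [V]. *)
  move=> c; have : V *m (alpha (scalar_center n.+1 c) : 'M_n.+1) *m U =
      (beta (val c) : R)%:M.
    rewrite alphaE antitranspose_scalar !mulmxA VU mul1mx -mulmxA VU.
    exact: mulmx1.
  rewrite alpha_sigma mulmx_central_scalar -scalemxAl VU scalemx1.
  by move=> /matrixP/(_ 0 0); rewrite !mxE eqxx.
split=> [[alpha [alpha_bij alphaK alpha_sigma]] | [alpha [alpha_bij alpha_sigma]]].
  have [beta [_ beta_sigma [U [V [UV VU alphaE]]]]] := key _ alpha_bij alpha_sigma.
  have invol : involutive (fun X => U *m antitranspose beta X *m V).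
    by move=> X; rewrite -!alphaE alphaK.
  have [w [w' [ww' w'w beta_w beta2]]] := involution_antitranspose UV VU invol.
  exact: involution_mx2 ww' w'w beta_w beta2 beta_sigma.
by have [beta [beta_bij beta_sigma _]] := key _ alpha_bij alpha_sigma; exists beta.
Qed.
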